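(* Let $(G_n)_{n\geq 0}$ be an expander (in the sense defined in the context). For any $c\in\,]0,1[$, there exists a sequence $(p^*_n(c))_{n\ge 0}$ of numbers in $[0,1]$, bounded away from zero and one (i.e. there exist $0<a<a'<1$ with $p^*_n(c)\in[a,a']$ for all $n$), such that for every $\varepsilon>0$ and every sequence $(p_n)_{n\ge0}$ in $[0,1]$: (i) if $p_n \geq p^*_n(c)+\varepsilon$ for all $n$, then \[ \lim_{n\to \infty}\mathbb{P}\big(G_n(p_n) \text{ contains a connected component with at least } c|V_n| \text{ vertices}\big) = 1; \] (ii) if $p_n \leq p^*_n(c)-\varepsilon$ for all $n$, then \[ \lim_{n\to \infty}\mathbb{P}\big(G_n(p_n) \text{ contains a connected component with at least } c|V_n| \text{ vertices}\big) = 0. \]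
   Context: For a finite graph $G=(V,E)$ and sets of vertices $A,B$, $E(A,B)$ denotes the set of edges with one endpoint in $A$ and the other in $B$. The Cheeger constant (edge-isoperimetric number) of $G$ is $c(G)=\min_{A\subset V,\,0<|A|\le |V|/2} |E(A,A^c)|/|A|$. An expander is a sequence of finite graphs $G_n=(V_n,E_n)$ for which there are constants $b>0$ and $d\in\mathbb{N}^*$ such that for every $n$ the maximal degree of $G_n$ is at most $d$ and $c(G_n)>b$, and moreover $|V_n|\to\infty$ as $n\to\infty$. For $p\in[0,1]$, $G(p)$ denotes the random spanning subgraph of $G$ obtained by retaining each edge of $G$ independently with probability $p$. *)

(* Defs.v *)
From HB Require Import structures.
From mathcomp Require Import all_boot all_order all_algebra.
From mathcomp Require Import all_classical all_reals topology normedtype sequences.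
Set Implicit Arguments. Unset Strict Implicit. Unset Printing Implicit Defensive.
Import Order.TTheory GRing.Theory Num.Theory.
Local Open Scope ring_scope.

Definition simple_graph (T : finType) (e : rel T) : Prop :=
  symmetric e /\ irreflexive e.

Definition edges (T : finType) (e : rel T) : {set {set T}} :=
  [set s | [exists x, exists y, e x y && (s == [set x; y])]].

(* |E(A, A^c)|: each edge with one endpoint in A and the other outside A is
   counted once, as the ordered pair (x,y) with x in A, y not in A. *)
Definition boundary_size (T : finType) (e : rel T) (A : {set T}) : nat :=
  #|[set xy : T * T | [&& xy.1 \in A, xy.2 \notin A & e xy.1 xy.2]]|.

Definition max_degree_le (T : finType) (e : rel T) (d : nat) : Prop :=
  forall x : T, (#|[set y | e x y]| <= d)%N.

Definition cheeger_gt (R : realType) (T : finType) (e : rel T) (b : R) : Prop :=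
  forall A : {set T}, (0 < #|A|)%N -> (#|A|%:R <= #|T|%:R / 2 :> R) ->
    b < (boundary_size e A)%:R / #|A|%:R.

Definition expander (R : realType) (T : nat -> finType) (e : forall n, rel (T n)) : Prop :=
  (forall n, simple_graph (e n)) /\
  (exists (b : R) (d : nat), 0 < b /\ (0 < d)%N /\
     forall n, max_degree_le (e n) d /\ cheeger_gt (e n) b) /\
  (forall M : nat, exists N : nat, forall n, (N <= n)%N -> (M <= #|T n|)%N).

Definition retained (T : finType) (w : {set {set T}}) : rel T :=
  fun x y => [set x; y] \in w.

Definition has_giant (R : realType) (T : finType) (c : R) (w : {set {set T}}) : bool :=
  [exists x : T, c * #|T|%:R <= #|[set y | connect (retained w) x y]|%:R].

Definition prob_giant (R : realType) (T : finType) (e : rel T) (p c : R) : R :=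
  \sum_(w : {set {set T}} | (w \subset edges e) && has_giant c w)
     p ^+ #|w| * (1 - p) ^+ (#|edges e| - #|w|).

(* Main.v *)
(** Let [n] be the number of vertices and [N_k] the number of vertices lying in
    open clusters of size at least [k].  Suppose that a cluster of size at least
    [c n] exists at level [p] with probability at least [delta], and sprinkle
    [eps] in two halves.
    - Such a cluster, if it is not much larger than [c n], has linearly many
      boundary edges by expansion; the first half opens a positive fraction of
      them, so with probability bounded below [N_k >= (c + 2 h) n] for some
      [h > 0] that depends only on [eps], [c], [b], [d].
    - Flipping one edge changes [N_k] by at most [2 k], so by Efron-Stein and
      Chebyshev [N_k >= (c + h) n] with probability tending to one.
    - If no cluster of size [c n] exists after the second half, then the clusters
      of size at least [k] split into two groups of at least [h n] vertices each
      that are not connected by sprinkled edges.  Two such sets are joined in the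
      expander by linearly many edge-disjoint paths of bounded length, so this is
      exponentially unlikely for a given splitting, while for large [k] there are
      only [2 ^ (n / k)] splittings.
    Hence the probability climbs from [delta] to [1 - delta] on an interval of
    length [eps].  The threshold is the level where it crosses [1 / 2]; first
    moment bounds keep that level away from [0] and [1]. *)

Require Import Defs.
From HB Require Import structures.
From mathcomp Require Import all_boot all_order all_algebra.
From mathcomp Require Import all_classical all_reals topology normedtype sequences.
From mathcomp Require Import ring lra.
Import mathcomp.boot.fintype mathcomp.boot.finset.
Set Implicit Arguments.
Unset Strict Implicit.
Unset Printing Implicit Defensive.
Import Order.TTheory GRing.Theory Num.Theory.
Import numFieldNormedType.Exports.
Local Open Scope ring_scope.

(** * Expectation of a function of a random subset *)

Section Expectation.
Context {R : realType} {I : finType}.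
Implicit Types (p q C M t : R) (s : seq I) (f g h : {set I} -> R).

(* For duplicate-free [s], the expectation of [f w] where [w] contains each item
   of [s] independently with probability [p]; see [expecE]. *)
Fixpoint expec p s f : R :=
  if s is i :: s' then
    (1 - p) * expec p s' f + p * expec p s' (fun w => f (i |: w))
  else f set0.

Lemma expec_le p s f g : 0 <= p <= 1 ->
  (forall w : {set I}, {subset w <= s} -> f w <= g w) ->
  expec p s f <= expec p s g.
Proof.
move=> /andP[p0 p1]; elim: s f g => [|i s IH] f g fg /=.
  by apply: fg => x; rewrite inE.
apply: lerD; apply: ler_wpM2l => //; rewrite ?subr_ge0 //.
  by apply: IH => w ws; apply: fg => x /ws xs; rewrite inE xs orbT.
apply: IH => w ws; apply: fg => x; rewrite !inE => /orP[->//|/ws ->].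
by rewrite orbT.
Qed.

Lemma eq_expec p s f g :
  (forall w : {set I}, {subset w <= s} -> f w = g w) ->
  expec p s f = expec p s g.
Proof.
elim: s f g => [|i s IH] f g fg /=; first by apply: fg => x; rewrite inE.
congr (_ * _ + _ * _); apply: IH => w ws; apply: fg => x.
  by move=> /ws xs; rewrite inE xs orbT.
by rewrite !inE => /orP[->//|/ws ->]; rewrite orbT.
Qed.

Lemma expec_cst p s C : expec p s (fun _ => C) = C.
Proof. by elim: s => //= i s ->; ring. Qed.

Lemma expecD p s f g :
  expec p s (fun w => f w + g w) = expec p s f + expec p s g.
Proof. by elim: s f g => //= i s IH f g; rewrite !IH; ring. Qed.

Lemma expecZ p s C f : expec p s (fun w => C * f w) = C * expec p s f.
Proof. by elim: s f => //= i s IH f; rewrite !IH; ring. Qed.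

Lemma expec_sum p s (J : finType) (P : pred J) (F : J -> {set I} -> R) :
  expec p s (fun w => \sum_(j | P j) F j w) = \sum_(j | P j) expec p s (F j).
Proof.
elim: s F => //= i s IH F.
by rewrite !IH !mulr_sumr -big_split.
Qed.

Lemma expec_ge0 p s f : 0 <= p <= 1 -> (forall w, 0 <= f w) ->
  0 <= expec p s f.
Proof.
move=> p01 f0; rewrite -(expec_cst p s 0).
by apply: expec_le => // w _.
Qed.

(* Sprinkling: the union of two independent random subsets is a random subset. *)
Lemma expecU p q s f :
  expec p s (fun w => expec q s (fun w' => f (w :|: w'))) =
  expec (1 - (1 - p) * (1 - q)) s f.
Proof.
elim: s f => [|i s IH] f /=; first by rewrite setU0.
rewrite !expecD !expecZ IH.
have -> : (fun w => expec q s (fun w' => f (w :|: (i |: w')))) =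
          (fun w => expec q s (fun w' => f (i |: (w :|: w')))).
  by apply/funext => w; congr expec; apply/funext => w'; rewrite setUCA.
have -> : (fun w => expec q s (fun w' => f (i |: w :|: w'))) =
          (fun w => expec q s (fun w' => f (i |: (w :|: w')))).
  by apply/funext => w; congr expec; apply/funext => w'; rewrite setUA.
have -> : (fun w => expec q s (fun w' => f (i |: w :|: (i |: w')))) =
          (fun w => expec q s (fun w' => f (i |: (w :|: w')))).
  apply/funext => w; congr expec; apply/funext => w'.
  by rewrite -setUUr.
by rewrite (IH (fun w => f (i |: w))); ring.
Qed.

(** Monotone coupling: the level [p'] is reached from [p] by sprinkling, which can only increase
    [f]. *)
Lemma expec_incr p p' s f : 0 <= p -> p <= p' -> p' <= 1 ->
  (forall w w', f w <= f (w :|: w')) -> expec p s f <= expec p' s f.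
Proof.
move=> p0 pp' p'1 f_incr; have [p1|p1] := leP 1 p.
  by have -> : p = p' by lra.
(* The solution of [1 - (1 - p) * (1 - q) = p']; the case [p = 1] was set aside for this
   division. *)
pose q := (p' - p) / (1 - p).
have q01 : 0 <= q <= 1.
  by rewrite divr_ge0 ?subr_ge0 ?(ltW p1) //= ler_pdivrMr ?subr_gt0 // mul1r; lra.
have <- : 1 - (1 - p) * (1 - q) = p'.
  by rewrite /q; field; rewrite lt0r_neq0 // subr_gt0.
rewrite -expecU; apply: expec_le => [|w _]; first by rewrite p0 ltW.
rewrite -[leLHS](expec_cst q s); exact: expec_le.
Qed.

(** Each item influences at most one of the two factors, so conditioning on it leaves the other
    factor unchanged. *)
Lemma expec_indep p s g h :
  (forall i, i \in s ->
     (forall w, g (i |: w) = g w) \/ (forall w, h (i |: w) = h w)) ->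
  expec p s (fun w => g w * h w) = expec p s g * expec p s h.
Proof.
elim: s g h => //= i s IH g h gh.
have gh' j : j \in s ->
    (forall w, g (j |: w) = g w) \/ (forall w, h (j |: w) = h w).
  by move=> js; apply: gh; rewrite inE js orbT.
rewrite IH //; have [gi|hi] := gh i (mem_head _ _).
  have -> : (fun w => g (i |: w) * h (i |: w)) = (fun w => g w * h (i |: w)).
    by apply/funext => w; rewrite gi.
  have -> : (fun w => g (i |: w)) = g by apply/funext => w; rewrite gi.
  rewrite (IH g (fun w => h (i |: w))); first by ring.
  move=> j /gh'[gj|hj]; [by left | right => w].
  by rewrite setUCA hj.
have -> : (fun w => g (i |: w) * h (i |: w)) = (fun w => g (i |: w) * h w).
  by apply/funext => w; rewrite hi.
have -> : (fun w => h (i |: w)) = h by apply/funext => w; rewrite hi.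
rewrite (IH (fun w => g (i |: w)) h); first by ring.
move=> j /gh'[gj|hj]; [left => w | by right].
by rewrite setUCA gj.
Qed.

Lemma expec_subset p s (P : {set I}) : uniq s -> {subset P <= s} ->
  expec p s (fun w => (P \subset w)%:R) = p ^+ #|P|.
Proof.
elim: s P => [|i s IH] P /=.
  move=> _ Ps; suff -> : P = set0 by rewrite sub0set cards0.
  by apply/setP => x; rewrite inE; apply/negbTE/negP => /Ps.
move=> /andP[iNs us] Ps.
have sub w : (P \subset i |: w) = (P :\ i \subset w).
  by rewrite subDset.
have -> : (fun w => (P \subset i |: w)%:R) = (fun w => (P :\ i \subset w)%:R :> R).
  by apply/funext => w; rewrite sub.
have P's : {subset P :\ i <= s}.
  by move=> x; rewrite !inE => /andP[/negbTE xi /Ps]; rewrite inE xi.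
rewrite (IH (P :\ i)) //.
have [iP|iNP] := boolP (i \in P).
  rewrite (@eq_expec _ _ _ (fun=> 0)).
    by rewrite expec_cst (cardsD1 i P) iP exprS; ring.
  move=> w ws; case: (boolP (P \subset w)) => // /subsetP/(_ _ iP)/ws.
  by rewrite (negbTE iNs).
have -> : P :\ i = P.
  by apply/setP => x; rewrite !inE; case: eqVneq => // ->; rewrite (negbTE iNP).
by rewrite IH //; [ring | move=> x xP; apply: P's; rewrite !inE xP andbT;
  apply: contraNneq iNP => <-].
Qed.

Lemma expec_card p s (F : {set I}) : uniq s -> {subset F <= s} ->
  expec p s (fun w => #|F :&: w|%:R) = p * #|F|%:R.
Proof.
move=> us Fs.
have -> : (fun w => #|F :&: w|%:R) =
    (fun w => \sum_(i in F) ([set i] \subset w)%:R :> R).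
  apply/funext => w; rewrite -sum1_card natr_sum.
  rewrite [RHS](bigID (fun i => i \in w)) /= [X in _ + X]big1 ?addr0.
    apply: eq_big => i; first by rewrite inE.
    by rewrite inE sub1set => /andP[_ ->].
  by move=> i /andP[_ /negbTE iw]; rewrite sub1set iw.
rewrite expec_sum (eq_bigr (fun=> p)) => [|i iF].
  by rewrite sumr_const mulr_natr.
rewrite expec_subset ?cards1 ?expr1 // => x.
by rewrite inE => /eqP ->; apply: Fs.
Qed.

(* Efron-Stein inequality for functions with bounded differences. *)
Lemma expec_var p s f C : 0 <= p <= 1 ->
  (forall i w, i \in s -> `|f (i |: w) - f w| <= C) ->
  expec p s (fun w => f w ^+ 2) - (expec p s f) ^+ 2 <= (size s)%:R * C ^+ 2.
Proof.
move=> p01; elim: s f => [|i s IH] f fC /=; first by rewrite subrr mul0r.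
have fC' j w : j \in s -> `|f (j |: w) - f w| <= C.
  by move=> js; apply: fC; rewrite inE js orbT.
have v0 := IH f fC'.
have v1 : expec p s (fun w => f (i |: w) ^+ 2) -
    (expec p s (fun w => f (i |: w))) ^+ 2 <= (size s)%:R * C ^+ 2.
  apply: (IH (fun w => f (i |: w))) => j w js; rewrite setUCA.
  exact: fC'.
have [p0 p1] := andP p01.
have dC : (expec p s (fun w => f (i |: w)) - expec p s f) ^+ 2 <= C ^+ 2.
  have fi w : `|f (i |: w) - f w| <= C by apply: fC; rewrite mem_head.
  have C0 : 0 <= C by apply: le_trans (fi set0).
  rewrite -ler_sqrt ?sqr_ge0 // !sqrtr_sqr (ger0_norm C0) ler_norml.
  apply/andP; split.
    rewrite lerBrDr -(expec_cst p s (- C)) -expecD.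
    by apply: expec_le => // w _; have := fi w; rewrite ler_norml => /andP[] *; lra.
  rewrite lerBlDr -[X in X + _](expec_cst p s) -expecD.
  by apply: expec_le => // w _; have := fi w; rewrite ler_norml => /andP[] *; lra.
move: v0 v1 dC; set Q0 := expec p s _; set Q1 := expec p s (fun w => f _ ^+ 2).
set a0 := expec p s f; set a1 := expec p s _; set V := (size s)%:R * C ^+ 2 => v0 v1 dC.
(* Law of total variance, conditioning on item [i]: two conditional variances plus the variance of
   the conditional mean. *)
have -> : (1 - p) * Q0 + p * Q1 - ((1 - p) * a0 + p * a1) ^+ 2 =
  (1 - p) * (Q0 - a0 ^+ 2) + p * (Q1 - a1 ^+ 2) + p * (1 - p) * (a1 - a0) ^+ 2.
  by ring.
have -> : (size s).+1%:R * C ^+ 2 = (1 - p) * V + p * V + C ^+ 2.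
  by rewrite -natr1 /V; ring.
apply: lerD; first by apply: lerD; apply: ler_wpM2l => //; lra.
apply: le_trans dC; rewrite -[leRHS]mul1r; apply: ler_wpM2r; first exact: sqr_ge0.
by nra.
Qed.

Lemma expec_chebyshev p s f C t : 0 <= p <= 1 -> 0 <= t ->
  (forall i w, i \in s -> `|f (i |: w) - f w| <= C) ->
  expec p s (fun w => (t <= `|f w - expec p s f|)%R%:R) * t ^+ 2
    <= (size s)%:R * C ^+ 2.
Proof.
move=> p01 t0 fC; set mu := expec p s f.
apply: le_trans (expec_var p01 fC).
have -> : expec p s (fun w => f w ^+ 2) - expec p s f ^+ 2 =
    expec p s (fun w => (f w - mu) ^+ 2).
  have -> : (fun w => (f w - mu) ^+ 2) =
      (fun w => f w ^+ 2 + ((- 2 * mu) * f w + mu ^+ 2)).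
    by apply/funext => w; ring.
  by rewrite !expecD expecZ expec_cst -/mu; ring.
rewrite mulrC -expecZ; apply: expec_le => // w _.
case: (boolP (t <= _)) => [tf|_]; last by rewrite mulr0 sqr_ge0.
rewrite mulr1 -[leRHS]real_normK ?num_real //.
by rewrite ler_sqr ?nnegrE // normr_ge0.
Qed.

Lemma expec_markov p s f t : 0 <= p <= 1 -> (forall w, 0 <= f w) ->
  t * expec p s (fun w => (t <= f w)%R%:R) <= expec p s f.
Proof.
move=> p01 f0; rewrite -expecZ; apply: expec_le => // w _.
by case: (boolP (t <= f w)) => [tf|_]; rewrite ?mulr1 ?mulr0.
Qed.

(** Pointwise, [f] is at most [M] on the event and at most [t] off it. This bounds from below the
    chance that sprinkling opens many boundary edges. *)
Lemma expec_reverse_markov p s f M t : 0 <= p <= 1 -> 0 <= t ->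
  (forall w, f w <= M) ->
  expec p s f - t <= M * expec p s (fun w => (t <= f w)%R%:R).
Proof.
move=> p01 t0 fM; rewrite lerBlDr -expecZ -[X in _ + X](expec_cst p s) -expecD.
apply: expec_le => // w _.
case: (boolP (t <= f w)) => [tf|]; first by rewrite mulr1; have := fM w; lra.
by rewrite -ltNge mulr0 add0r => /ltW.
Qed.

(** Bridge to the explicit sum in [prob_giant]; the subsets are sorted by whether they contain the
    head of [s]. *)
Lemma expecE p s f : uniq s ->
  expec p s f = \sum_(w : {set I} | w \subset s)
    p ^+ #|w| * (1 - p) ^+ (size s - #|w|) * f w.
Proof.
elim: s f => [|i s IH] f /=.
  move=> _; rewrite (big_pred1 set0) => [|w].
    by rewrite cards0 subn0 !expr0 !mul1r.
  rewrite /= -subset0; apply/idP/idP => /subsetP ws; apply/subsetP => x /ws;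
    by rewrite inE.
move=> /andP[iNs us].
have sz (w : {set I}) : w \subset s -> (#|w| <= size s)%N.
  by move=> ws; rewrite -(card_uniqP us); apply: subset_leq_card.
rewrite !IH // [RHS](bigID (fun w : {set I} => i \in w)) /= [LHS]addrC; congr (_ + _).
  rewrite mulr_sumr [RHS](reindex_onto (fun w => i |: w) (fun w => w :\ i)) /=;
    last by move=> w /andP[_ iw]; rewrite setD1K.
  apply: eq_big => w.
    rewrite setU11 andbT; apply/idP/idP.
      move=> /subsetP ws.
      have iNw : i \notin w by apply: contra iNs => /ws.
      rewrite setU1K // eqxx andbT; apply/subsetP => x.
      by rewrite !inE => /orP[->//|/ws ->]; rewrite orbT.
    move=> /andP[/subsetP ws /eqP wi]; apply/subsetP => x xw.
    have : x != i by rewrite -wi !inE in xw; case/andP: xw.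
    by have := ws x; rewrite !inE xw orbT => /(_ isT)/orP[->|].
  move=> ws; have iNw : i \notin w by apply: contra iNs => /(subsetP ws).
  rewrite cardsU1 iNw add1n subSS exprS; ring.
rewrite mulr_sumr; apply: eq_big => w.
  apply/idP/andP => [ws|[/subsetP ws iNw]].
    split; first by apply: subset_trans ws _; apply/subsetP => x; rewrite inE => ->; rewrite orbT.
    by apply: contra iNs => /(subsetP ws).
  apply/subsetP => x xw; have := ws x xw; rewrite inE => /orP[/eqP xi|//].
  by rewrite -xi xw in iNw.
by move=> ws; rewrite subSn ?sz // exprS; ring.
Qed.

End Expectation.

(** * Open clusters *)

Section Clusters.
Context {T : finType}.
Implicit Types (w : {set {set T}}) (S Z : {set T}) (x y : T) (k : nat).

Definition open_cluster w x : {set T} := [set y | connect (retained w) x y].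

(** The stable sets are exactly the unions of open clusters. *)
Definition stable w S := [forall x in S, open_cluster w x \subset S].

Definition large k w : {set T} := [set x | (k <= #|open_cluster w x|)%N].

Lemma retained_sym w : connect_sym (retained w).
Proof. by apply: sym_connect_sym => x y; rewrite /retained setUC. Qed.

Lemma connect_mono w w' : w \subset w' ->
  subrel (connect (retained w)) (connect (retained w')).
Proof.
move=> ww'; apply: connect_sub => x y xy; apply: connect1.
exact: (subsetP ww').
Qed.

Lemma cluster_mono w w' x : w \subset w' -> open_cluster w x \subset open_cluster w' x.
Proof.
by move=> ww'; apply/subsetP => y; rewrite !inE; apply: connect_mono.
Qed.

Lemma cluster_refl w x : x \in open_cluster w x.
Proof. by rewrite inE connect0. Qed.

Lemma eq_cluster w x y : y \in open_cluster w x -> open_cluster w x = open_cluster w y.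
Proof.
rewrite inE => xy; apply/setP => z; rewrite !inE.
exact: (same_connect (retained_sym w)).
Qed.

Lemma cluster_closed w S x : (forall u v, u \in S -> retained w u v -> v \in S) ->
  x \in S -> open_cluster w x \subset S.
Proof.
move=> clS xS; apply/subsetP => y; rewrite inE => xy.
rewrite -(@closed_connect _ (retained w) (mem S) _ x y) //.
by apply: (intro_closed (retained_sym w)) => u v uv uS; apply: clS uv.
Qed.

Lemma stableP w S x y : stable w S -> x \in S -> connect (retained w) x y -> y \in S.
Proof.
by move=> /forall_inP stS /stS/subsetP sub xy; apply: sub; rewrite inE.
Qed.

Lemma stable_setD w S x : stable w S -> stable w (S :\: open_cluster w x).
Proof.
move=> stS; apply/forall_inP => y; rewrite in_setD => /andP[yNx yS].
apply/subsetP => z; rewrite inE => yz; rewrite in_setD (stableP stS yS yz) andbT.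
apply: contra yNx; rewrite !inE => xz; apply: connect_trans xz _.
by rewrite retained_sym.
Qed.

Lemma large_mono k w w' : w \subset w' -> large k w \subset large k w'.
Proof.
move=> ww'; apply/subsetP => x; rewrite !inE => kx; apply: leq_trans kx _.
exact/subset_leq_card/cluster_mono.
Qed.

(** A vertex that becomes large had a cluster of size below [k], and that cluster was the one of [x]
    or of [y], since the new edge changes no other. *)
Lemma card_large_insert k w x y :
  (#|large k ([set x; y] |: w)| <= #|large k w| + 2 * k)%N.
Proof.
pose U v := if (#|open_cluster w v| < k)%N then open_cluster w v else set0.
have cU v : (#|U v| <= k)%N by rewrite /U; case: ifP => [/ltnW//|]; rewrite cards0.
suff sub : large k ([set x; y] |: w) \subset large k w :|: (U x :|: U y).
  apply: leq_trans (subset_leq_card sub) _.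
  apply: leq_trans (leq_card_setU _ _) _; rewrite leq_add2l mul2n -addnn.
  by apply: leq_trans (leq_card_setU _ _) _; apply: leq_add.
apply/subsetP => z zL; rewrite in_setU.
have [//|] := boolP (z \in large k w); rewrite inE -ltnNge /= => zk.
have zU v : z \in open_cluster w v -> z \in U v.
  by move=> zv; rewrite /U (eq_cluster zv) zk -(eq_cluster zv).
rewrite in_setU; have [zx|zNx] := boolP (z \in open_cluster w x); first by rewrite zU.
have [zy|zNy] := boolP (z \in open_cluster w y); first by rewrite (zU y) // orbT.
suff : open_cluster ([set x; y] |: w) z \subset open_cluster w z.
  move/subset_leq_card => le; move: zL; rewrite inE => /leq_trans/(_ le).
  by rewrite leqNgt zk.
apply: cluster_closed; last exact: cluster_refl.
move=> u v uz; rewrite /retained in_setU1 => /orP[/eqP uv|uv].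
  have : u \in [set x; y] by rewrite -uv set21.
  rewrite !inE => /orP[] /eqP ux; subst u.
    by move: zNx; rewrite -(eq_cluster uz) cluster_refl.
  by move: zNy; rewrite -(eq_cluster uz) cluster_refl.
rewrite inE; move: uz; rewrite inE => zu; apply: connect_trans zu _.
exact: connect1.
Qed.

(* A stable set of minimal cardinality among those meeting [Z] in at least [t]
   points is a single open_cluster or meets [Z] in less than [2 * t] points. *)
Lemma stable_split (R : realType) w Z (t : R) : 3 * t <= #|Z|%:R ->
  (forall x, #|open_cluster w x :&: Z|%:R <= #|Z|%:R - t) ->
  exists2 S, stable w S & t <= #|S :&: Z|%:R <= #|Z|%:R - t.
Proof.
move=> tZ cZ; pose P S := stable w S && (t <= #|S :&: Z|%:R).
have PT : P setT.
  apply/andP; split; first by apply/forall_inP => x _; apply: subsetT.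
  by rewrite setTI; have : 0 <= #|Z|%:R :> R by []; lra.
case: (@arg_minnP _ setT P (fun S => #|S|) PT) => S /andP[stS tS] Smin.
have [S0|[x xS]] := set_0Vmem S.
  exists S => //; rewrite tS S0 set0I cards0 /=.
  by move: tS; rewrite S0 set0I cards0; have : 0 <= #|Z|%:R :> R by []; lra.
have xsub : open_cluster w x \subset S by move/forall_inP: (stS); apply.
have [tx|tx] := leP t #|open_cluster w x :&: Z|%:R.
  exists (open_cluster w x); last by rewrite tx cZ.
  apply/forall_inP => y /eq_cluster <-; exact: subxx.
exists S => //; rewrite tS /=.
(* Removing a cluster leaves a smaller stable set, so minimality makes the rest meet [Z] in fewer
   than [t] points. *)
have lt_t : #|(S :\: open_cluster w x) :&: Z|%:R < t.
  rewrite ltNge; apply/negP => tD.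
  have /Smin : P (S :\: open_cluster w x) by rewrite /P stable_setD.
  rewrite leqNgt => /negP; apply; apply: proper_card.
  apply/properP; split; first exact: subsetDl.
  by exists x; rewrite // inE cluster_refl.
have -> : #|S :&: Z| = (#|open_cluster w x :&: Z| + #|(S :\: open_cluster w x) :&: Z|)%N.
  rewrite -(cardsID (open_cluster w x) (S :&: Z)); congr (_ + _)%N.
    by rewrite setIAC (setIidPr xsub).
  by rewrite setIDAC.
by rewrite natrD; lra.
Qed.

(** Distinct clusters are disjoint, and each one counted here has at least [k] vertices. *)
Lemma card_large_clusters k w :
  (k * #|[set open_cluster w x | x in large k w]| <= #|T|)%N.
Proof.
set C := [set _ | _ in _].
have /eqP sumC : trivIset C.
  apply/trivIsetP => _ _ /imsetP[x _ ->] /imsetP[y _ ->]; apply: contraR.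
  rewrite -setI_eq0 => /set0Pn[z]; rewrite inE => /andP[zx zy].
  by rewrite (eq_cluster zx) -(eq_cluster zy).
apply: leq_trans (max_card (mem (cover C))); rewrite -sumC mulnC -sum_nat_const.
by apply: leq_sum => _ /imsetP[x xk ->]; rewrite inE in xk.
Qed.

End Clusters.

Lemma card_imset_snd (S T : finType) (D : {set S * T}) d :
  (forall y, #|[set x | (x, y) \in D]| <= d)%N ->
  (#|D| <= d * #|[set z.2 | z in D]|)%N.
Proof.
move=> dD; rewrite -sum1_card (partition_big_imset snd) /=.
rewrite mulnC -sum_nat_const; apply: leq_sum => y _.
rewrite sum1dep_card; apply: leq_trans (dD y).
rewrite -(@card_in_imset _ _ fst).
  apply: subset_leq_card; apply/subsetP => _ /imsetP[[x z] xz ->].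
  by move: xz; rewrite !inE /= => /andP[xzD /eqP <-].
move=> [x z] [x' z']; rewrite !inE /= => /andP[_ /eqP ->] /andP[_ /eqP ->].
by move=> ->.
Qed.

(** * Edge cuts and short paths in expanders *)

Section Cuts.
Context {T : finType} (e : rel T) (d : nat).
Hypotheses (e_simple : simple_graph e) (e_deg : max_degree_le e d).
Implicit Types (w G F : {set {set T}}) (S : {set T}) (x y : T).

Definition out_pairs S : {set T * T} :=
  [set z | [&& z.1 \in S, z.2 \notin S & e z.1 z.2]].

(** Unordered form of the boundary, so that it can be intersected with a random edge set. *)
Definition edge_cut S : {set {set T}} := [set [set z.1; z.2] | z in out_pairs S].

Lemma mem_edges x y : e x y -> [set x; y] \in edges e.
Proof.
by move=> xy; rewrite inE; apply/existsP; exists x; apply/existsP; exists y; rewrite xy eqxx.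
Qed.

Lemma edgesP i : i \in edges e -> exists x y, e x y /\ i = [set x; y].
Proof.
by rewrite inE => /existsP[x /existsP[y /andP[xy /eqP ->]]]; exists x, y.
Qed.

Lemma card_neighbours y : (#|[set x | e x y]| <= d)%N.
Proof.
apply: leq_trans (e_deg y); rewrite subset_leq_card //.
by apply/subsetP => x; rewrite !inE e_simple.1.
Qed.

Lemma card_edges : (#|edges e| <= d * #|T|)%N.
Proof.
pose D := [set z : T * T | e z.1 z.2].
have sub : edges e \subset [set [set z.1; z.2] | z in D].
  apply/subsetP => i /edgesP[x [y [xy ->]]].
  by apply/imsetP; exists (x, y); rewrite ?inE.
apply: leq_trans (subset_leq_card sub) _; apply: leq_trans (leq_imset_card _ _) _.
apply: leq_trans (card_imset_snd (d := d) _) _.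
  move=> y; apply: leq_trans (card_neighbours y); apply: subset_leq_card.
  by apply/subsetP => x; rewrite !inE.
by rewrite leq_mul2l max_card orbT.
Qed.

Lemma edge_cutP S i : reflect
  (exists x y, [/\ x \in S, y \notin S, e x y & i = [set x; y]]) (i \in edge_cut S).
Proof.
apply: (iffP imsetP) => [[[x y]]|[x [y [xS yS xy ->]]]].
  by rewrite inE => /and3P[xS yS xy] ->; exists x, y.
by exists (x, y) => //; rewrite inE xS yS xy.
Qed.

Lemma edge_cut_sub S : edge_cut S \subset edges e.
Proof. by apply/subsetP => i /edge_cutP[x [y [_ _ xy ->]]]; apply: mem_edges. Qed.

(** Exactly one endpoint of a cut edge lies in [S], so the edge determines its orientation. *)
Lemma card_cut S : #|edge_cut S| = boundary_size e S.
Proof.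
apply: card_in_imset => -[x y] [x' y']; rewrite !inE /=.
move=> /and3P[xS yNS _] /and3P[x'S y'NS _] eq_xy.
have : x \in [set x'; y'] by rewrite -eq_xy set21.
have : y \in [set x'; y'] by rewrite -eq_xy set22.
rewrite !inE => /orP[/eqP yx'|/eqP ->]; first by rewrite yx' x'S in yNS.
by move=> /orP[/eqP ->//|/eqP xy']; rewrite xy' (negbTE y'NS) in xS.
Qed.

Definition outer S G : {set T} :=
  [set y | (y \notin S) && [exists x in S, e x y && ([set x; y] \in G)]].

(** Each outer vertex receives at most [d] cut edges; this turns edge expansion into vertex
    expansion. *)
Lemma card_cut_outer S G : (#|edge_cut S :&: G| <= d * #|outer S G|)%N.
Proof.
pose D := [set z in out_pairs S | [set z.1; z.2] \in G].
have sub : edge_cut S :&: G \subset [set [set z.1; z.2] | z in D].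
  apply/subsetP => i /setIP[/edge_cutP[x [y [xS yS xy ->]]] xyG].
  by apply/imsetP; exists (x, y); rewrite ?inE //= xS yS xy.
apply: leq_trans (subset_leq_card sub) _; apply: leq_trans (leq_imset_card _ _) _.
apply: leq_trans (card_imset_snd (d := d) _) _.
  move=> y; apply: leq_trans (card_neighbours y); apply: subset_leq_card.
  by apply/subsetP => x; rewrite !inE => /andP[/and3P[]].
rewrite leq_mul2l; apply/orP; right; apply: subset_leq_card.
apply/subsetP => _ /imsetP[[x y] + ->]; rewrite !inE /=.
move=> /andP[/and3P[xS yS xy] xyG]; rewrite yS.
by apply/exists_inP; exists x => //; rewrite xy.
Qed.

Lemma boundary_sizeC S : (boundary_size e (~: S) <= boundary_size e S)%N.
Proof.
pose sw (z : T * T) := (z.2, z.1).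
apply: leq_trans (leq_imset_card sw _); apply: subset_leq_card.
apply/subsetP => -[x y]; rewrite !inE /= negbK => /and3P[xS yS xy].
by apply/imsetP; exists (y, x); rewrite // !inE /= yS xS e_simple.1.
Qed.

End Cuts.

(** * Ball growth and short paths that avoid a set of edges *)

Section Expansion.
Context {R : realType} {T : finType} (e : rel T) (d : nat) (b : R).
Hypotheses (e_simple : simple_graph e) (e_deg : max_degree_le e d).
Hypotheses (e_cheeger : cheeger_gt e b) (b_gt0 : 0 < b) (d_gt0 : (0 < d)%N).
Hypothesis (T_gt0 : (0 < #|T|)%N).
Implicit Types (w F P : {set {set T}}) (S A B : {set T}) (x y : T).

Let n : R := #|T|%:R.

(** The Cheeger bound covers sets of at most half the vertices; a larger [S] is replaced by its
    complement, which still has at least [a * n] vertices. *)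
Lemma boundary_size_ge S (a : R) : 0 < a ->
  a * n <= #|S|%:R <= (1 - a) * n -> b * (a * n) <= (boundary_size e S)%:R.
Proof.
move=> a0 /andP[aS Sa]; have n0 : 0 < n by rewrite ltr0n.
have an0 : 0 < a * n by rewrite mulr_gt0.
have [Sn|Sn] := leP (#|S|%:R : R) (n / 2).
  have S0 : (0 < #|S|%:R :> R) by lra.
  have := e_cheeger _ Sn; rewrite -(ltr0n R) => /(_ S0).
  rewrite ltr_pdivlMr // => lt; apply: ltW (le_lt_trans _ lt).
  by rewrite ler_pM2l.
have eC : #|~: S|%:R = n - #|S|%:R :> R.
  by rewrite /n -(cardsC S) natrD; ring.
have S0 : (0 < #|~: S|%:R :> R) by rewrite eC; lra.
have Sn' : #|~: S|%:R <= n / 2 :> R by rewrite eC; lra.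
have := e_cheeger _ Sn'; rewrite -(ltr0n R) => /(_ S0).
rewrite ltr_pdivlMr // => lt.
have : (boundary_size e (~: S))%:R <= (boundary_size e S)%:R :> R.
  by rewrite ler_nat boundary_sizeC.
apply: le_trans; apply: ltW (le_lt_trans _ lt).
by rewrite ler_pM2l // eC; lra.
Qed.

(** The ball of radius [r] around [A] in the graph deprived of the edges [F]. *)
Fixpoint grow F A r : {set T} :=
  if r is r'.+1 then grow F A r' :|: outer e (grow F A r') (~: F) else A.

Lemma sub_grow F A r : A \subset grow F A r.
Proof.
elim: r => //= r IH; apply: subset_trans IH _; exact: subsetUl.
Qed.

Lemma grow_path F A r y : y \in grow F A r ->
  exists (P : {set {set T}}) x, [/\ P \subset edges e :\: F, (#|P| <= r)%N, x \in A &
    connect (retained P) x y].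
Proof.
elim: r y => /= [|r IH] y yA.
  by exists set0, y; rewrite sub0set cards0 connect0.
move: yA; rewrite in_setU => /orP[/IH[P [x [PF Pr xA xy]]]|].
  by exists P, x; split => //; apply: leqW.
rewrite inE => /andP[_ /exists_inP[z /IH[P [x [PF Pr xA xz]]] /andP[zy]]].
rewrite in_setC => zyF; exists ([set z; y] |: P), x; split => //.
- apply/subsetP => i; rewrite in_setU1 => /orP[/eqP ->|/(subsetP PF)//].
  by rewrite in_setD zyF mem_edges.
- by rewrite cardsU1; apply: (@leq_add _ _ 1) => //; apply: leq_b1.
apply: (@connect_trans _ _ z); first by apply: connect_mono xz; apply: subsetUr.
by apply: connect1; rewrite /retained setU11.
Qed.

(** Deleting [F] destroys at most half of the guaranteed cut edges, and the others lead to at least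
    a fraction [1 / d] as many vertices. *)
Lemma outer_card S F (h : R) : 0 < h -> h <= 2^-1 ->
  h * n <= #|S|%:R <= n / 2 -> #|F|%:R <= b * (h * n) / 2 ->
  b * (h * n) / (2 * d%:R) <= #|outer e S (~: F)|%:R.
Proof.
move=> h0 h2 /andP[hS Sh] Fh; have n0 : 0 < n by rewrite ltr0n.
have bS : b * (h * n) <= (boundary_size e S)%:R.
  apply: boundary_size_ge => //; rewrite hS /=; apply: le_trans Sh _.
  by rewrite mulrC ler_pM2r //; lra.
have : (#|edge_cut e S|%:R <= #|F|%:R + d%:R * #|outer e S (~: F)|%:R :> R).
  rewrite -natrM -natrD ler_nat -(cardsID F (edge_cut e S)) leq_add //.
    by rewrite subset_leq_card // subsetIr.
  by rewrite setDE card_cut_outer.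
rewrite card_cut => le; rewrite ler_pdivrMr ?mulr_gt0 ?ltr0n //.
by rewrite mulrCA; lra.
Qed.

Lemma grow_card F A r (h : R) : 0 < h -> h <= 2^-1 ->
  h * n <= #|A|%:R -> #|F|%:R <= b * (h * n) / 2 ->
  n / 2 < r%:R * (b * (h * n) / (2 * d%:R)) -> n / 2 < #|grow F A r|%:R.
Proof.
move=> h0 h2 hA Fh; set g := b * (h * n) / _.
(* As long as the ball holds at most half of the vertices, each round adds at least [g] new ones. *)
suff : n / 2 < #|grow F A r|%:R \/ r%:R * g <= #|grow F A r|%:R.
  by case=> // le lt; apply: lt_le_trans lt le.
elim: r => [|r [IH|IH]] /=; first by right; rewrite mul0r.
  by left; apply: lt_le_trans IH _; rewrite ler_nat subset_leq_card // subsetUl.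
have [lt|le] := ltP (n / 2) #|grow F A r|%:R.
  by left; apply: lt_le_trans lt _; rewrite ler_nat subset_leq_card // subsetUl.
right; rewrite cardsU.
have -> : grow F A r :&: outer e (grow F A r) (~: F) = set0.
  by apply/setP => y; rewrite !inE; case: (y \in grow F A r).
rewrite cards0 subn0 natrD -natr1 mulrDl mul1r lerD //.
apply: outer_card => //; rewrite le andbT; apply: le_trans hA _.
by rewrite ler_nat subset_leq_card // sub_grow.
Qed.

(** The balls of radius [r] around [A] and [B] each hold more than half of the vertices, hence they
    meet. *)
Lemma short_path F A B r (h : R) : 0 < h -> h <= 2^-1 ->
  h * n <= #|A|%:R -> h * n <= #|B|%:R -> #|F|%:R <= b * (h * n) / 2 ->
  d%:R < r%:R * (b * h) ->
  exists (P : {set {set T}}) x y, [/\ P \subset edges e :\: F, (#|P| <= 2 * r)%N,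
    x \in A, y \in B & connect (retained P) x y].
Proof.
move=> h0 h2 hA hB Fh rd; have n0 : 0 < n by rewrite ltr0n.
have d0 : 0 < d%:R :> R by rewrite ltr0n.
have rg : n / 2 < r%:R * (b * (h * n) / (2 * d%:R)).
  have -> : r%:R * (b * (h * n) / (2 * d%:R)) = (r%:R * (b * h)) / d%:R * (n / 2).
    by field; rewrite lt0r_neq0.
  by rewrite -[ltLHS]mul1r ltr_pM2r ?divr_gt0 // ltr_pdivlMr ?mul1r.
have cA := grow_card h0 h2 hA Fh rg; have cB := grow_card h0 h2 hB Fh rg.
have [I0|[z]] := set_0Vmem (grow F A r :&: grow F B r).
  have : (#|grow F A r :|: grow F B r|%:R <= n) by rewrite ler_nat max_card.
  by rewrite cardsU I0 cards0 subn0 natrD; lra.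
rewrite inE => /andP[/grow_path[P [x [PF Pr xA xz]]] /grow_path[Q [y [QF Qr yB yz]]]].
exists (P :|: Q), x, y; split => //; first by rewrite subUset PF.
  by rewrite mul2n -addnn; apply: leq_trans (leq_card_setU _ _) _; apply: leq_add.
apply: (@connect_trans _ _ z); first by apply: connect_mono xz; apply: subsetUl.
rewrite retained_sym; apply: connect_mono yz; exact: subsetUr.
Qed.

Definition unlinked A B w :=
  [forall x in A, forall y in B, ~~ connect (retained w) x y].

(* Short paths avoiding the edges already used are found greedily, so that the
   corresponding events are independent. *)
Lemma expec_unlinked (q : R) A B r m (h : R) F : 0 <= q <= 1 -> 0 < h -> h <= 2^-1 ->
  h * n <= #|A|%:R -> h * n <= #|B|%:R -> d%:R < r%:R * (b * h) ->
  #|F|%:R + (m * (2 * r))%:R <= b * (h * n) / 2 ->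
  expec q (enum (edges e)) (fun w => (unlinked A B (w :\: F))%:R)
    <= (1 - q ^+ (2 * r)) ^+ m.
Proof.
move=> q01 h0 h2 hA hB rd; have [q0 q1] := andP q01.
elim: m F => [|m IH] F Fm.
  rewrite expr0 -[leRHS](expec_cst q (enum (edges e))).
  by apply: expec_le => // w _; case: unlinked.
have Fh : #|F|%:R <= b * (h * n) / 2.
  by apply: le_trans Fm; rewrite lerDl.
have [P [x [y [PF Pr xA yB xy]]]] := short_path h0 h2 hA hB Fh rd.
(* If [A] and [B] are unlinked off [F], then [P] is not entirely open, and they stay unlinked once
   [P] is discarded as well. *)
have le : expec q (enum (edges e)) (fun w => (unlinked A B (w :\: F))%:R) <=
    expec q (enum (edges e))
     (fun w => (1 - (P \subset w)%:R) * (unlinked A B (w :\: (F :|: P)))%:R).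
  apply: expec_le => // w _; case sepF : (unlinked A B (w :\: F)); last first.
    by rewrite mulr_ge0 // subr_ge0 lern1 leq_b1.
  have -> : unlinked A B (w :\: (F :|: P)).
    apply/forall_inP => u uA; apply/forall_inP => v vB.
    move/forall_inP: sepF => /(_ u uA)/forall_inP/(_ v vB); apply: contra.
    by apply: connect_mono; rewrite setDS // subsetUl.
  case: (boolP (P \subset w)) => [Pw|_]; last by rewrite subr0 mulr1.
  move/forall_inP: sepF => /(_ x xA)/forall_inP/(_ y yB)/negP[].
  apply: connect_mono xy; apply/subsetP => i iP.
  by have := subsetP PF i iP; rewrite !inE => /andP[-> _]; rewrite (subsetP Pw).
apply: le_trans le _; rewrite expec_indep; last first.
  move=> i _; have [iP|iP] := boolP (i \in P); [right|left] => w.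
    congr ((unlinked _ _ _)%:R); apply/setP => j; rewrite !inE.
    by case: eqVneq => // ->; rewrite iP orbT.
  congr (1 - (nat_of_bool _)%:R); apply/idP/idP => /subsetP Pw; apply/subsetP => j jP.
    have := Pw j jP; rewrite inE => /orP[|//]; rewrite inE => /eqP ji.
    by rewrite -ji jP in iP.
  by rewrite inE Pw ?orbT.
rewrite exprS; apply: ler_pM.
- by apply: expec_ge0 => // w; rewrite subr_ge0 lern1 leq_b1.
- by apply: expec_ge0.
- have -> : (fun w : {set {set T}} => 1 - (P \subset w)%:R) =
            (fun w => 1 + (-1) * (P \subset w)%:R) :> (_ -> R).
    by apply/funext => w; rewrite mulN1r.
  rewrite expecD expec_cst expecZ expec_subset ?enum_uniq //; last first.
    by move=> i /(subsetP PF); rewrite inE mem_enum => /andP[].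
  by rewrite mulN1r lerD2l lerN2; apply: ler_wiXn2l.
(* Adding [P] to the forbidden edges costs at most [2 * r], the budget of one path. *)
apply: IH; apply: le_trans Fm; rewrite mulSn natrD addrA lerD2r -natrD ler_nat.
by apply: leq_trans (leq_card_setU _ _) _; rewrite leq_add2l.
Qed.

End Expansion.

(** * Giant components under sprinkling *)

Section Giant.
Context {R : realType} {T : finType} (e : rel T) (d : nat) (b : R).
Hypotheses (e_simple : simple_graph e) (e_deg : max_degree_le e d).
Hypotheses (e_cheeger : cheeger_gt e b) (b_gt0 : 0 < b) (d_gt0 : (0 < d)%N).
Hypothesis (T_gt0 : (0 < #|T|)%N).
Implicit Types (w F P : {set {set T}}) (S A B Z : {set T}) (x y : T).

Let n : R := #|T|%:R.
Let n_gt0 : 0 < n. Proof. by rewrite ltr0n. Qed.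
Let d0 : 0 < d%:R :> R. Proof. by rewrite ltr0n. Qed.

Lemma has_giantP (c : R) w :
  reflect (exists x, c * n <= #|open_cluster w x|%:R) (has_giant c w).
Proof. exact: existsP. Qed.

Lemma has_giantU (c : R) w w' : has_giant c w -> has_giant c (w :|: w').
Proof.
move=> /has_giantP[x cx]; apply/has_giantP; exists x; apply: le_trans cx _.
by rewrite ler_nat subset_leq_card // cluster_mono // subsetUl.
Qed.

(** Without a giant, every cluster meets [Z] in fewer than [c * n] points, so [stable_split]
    applies. *)
Lemma no_giant_split (c t : R) w Z : ~~ has_giant c w ->
  3 * t <= #|Z|%:R -> c * n + t <= #|Z|%:R ->
  exists2 S, stable w S & t <= #|S :&: Z|%:R <= #|Z|%:R - t.
Proof.
move=> /has_giantP small tZ cZ; apply: stable_split => // x.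
apply: (@le_trans _ _ (c * n)); last by lra.
apply/ltW; rewrite ltNge; apply/negP => le; apply: small; exists x.
by apply: le_trans le _; rewrite ler_nat subset_leq_card // subsetIl.
Qed.

(* The union bound runs over the families of large clusters of [w], of which
   there are at most [2 ^ (#|T| %/ k)]. *)
Lemma expec_merge (q c h : R) w k r m : 0 <= q <= 1 -> (0 < k)%N -> c < 1 ->
  0 < h -> 3 * h <= c -> (c + h) * n <= #|large k w|%:R ->
  d%:R < r%:R * (b * h) -> (m * (2 * r))%:R <= b * (h * n) / 2 ->
  expec q (enum (edges e)) (fun w' => (~~ has_giant c (w :|: w'))%:R)
    <= 2 ^+ (#|T| %/ k) * (1 - q ^+ (2 * r)) ^+ m.
Proof.
move=> q01 k0 c1 h0 h3 cZ rd mr; set Z := large k w in cZ.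
have hn0 : 0 < h * n by rewrite mulr_gt0.
pose CC := [set open_cluster w x | x in Z].
pose good (X : {set {set T}}) := [&& X \subset CC,
  h * n <= #|cover X|%:R & h * n <= #|Z :\: cover X|%:R].
set rho : R := 1 - _; have rho0 : 0 <= rho.
  by rewrite subr_ge0; case/andP: q01 => *; apply: exprn_ile1.
apply: (@le_trans _ _ (\sum_(X | good X) rho ^+ m)).
  pose Y (w' : {set {set T}}) : R :=
    \sum_(X | good X) (unlinked (cover X) (Z :\: cover X) w')%:R.
  apply: (@le_trans _ _ (expec q (enum (edges e)) Y)).
    apply: expec_le => // w' _.
    have [gnt|small] := boolP (has_giant c (w :|: w')); first by rewrite sumr_ge0.
    have [||S stS /andP[hS Sh]] := @no_giant_split c (h * n) _ Z small.
    - by apply: le_trans cZ; rewrite mulrA ler_pM2r //; lra.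
    - by apply: le_trans cZ; rewrite mulrDl.
    (* [S] is a union of clusters of [w :|: w'], hence of clusters of [w]; the large ones among
       these cover exactly [S :&: Z]. *)
    pose X := [set K in CC | K \subset S].
    have cX : cover X = S :&: Z.
      apply/setP => y; rewrite in_setI; apply/bigcupP/andP.
        move=> [K]; rewrite inE => /andP[/imsetP[x xZ ->] /subsetP KS] yx.
        split; first exact: KS.
        by move: xZ; rewrite !inE (eq_cluster yx).
      move=> [yS yZ]; exists (open_cluster w y); last exact: cluster_refl.
      rewrite inE; apply/andP; split; first by apply/imsetP; exists y.
      apply: subset_trans (cluster_mono _ (subsetUl w w')) _.
      by move/forall_inP: stS; apply.
    have goodX : good X.
      apply/and3P; split; first by apply/subsetP => K; rewrite inE => /andP[].
        by rewrite cX.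
      have : #|Z|%:R = #|S :&: Z|%:R + #|Z :\: (S :&: Z)|%:R :> R.
        by rewrite -natrD -(cardsID (S :&: Z) Z) setICA setIid.
      by rewrite cX; lra.
    rewrite /Y (bigD1 X goodX) /=.
    have -> : unlinked (cover X) (Z :\: cover X) w'.
      apply/forall_inP => x; rewrite cX => /setIP[xS _].
      apply/forall_inP => y; rewrite !inE => /andP[+ yZ]; apply: contra => xy.
      have yS : y \in S.
        by apply: (stableP stS xS); apply: connect_mono xy; apply: subsetUr.
      by rewrite yS.
    by rewrite lerDl sumr_ge0.
  rewrite /Y expec_sum; apply: ler_sum => X /and3P[_ hX hX'].
  have := @expec_unlinked R T e d b e_simple e_deg e_cheeger b_gt0 d_gt0 T_gt0
     q (cover X) (Z :\: cover X) r m h set0 q01 h0 _ hX hX' rd.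
  rewrite cards0 add0r => /(_ _ mr).
  have -> : (fun w => (unlinked (cover X) (Z :\: cover X) (w :\: set0))%:R : R) =
            (fun w => (unlinked (cover X) (Z :\: cover X) w)%:R).
    by apply/funext => w'; rewrite setD0.
  by apply; lra.
rewrite sumr_const -[leLHS]mulr_natl; apply: ler_wpM2r; first exact: exprn_ge0.
rewrite -natrX ler_nat; apply: (@leq_trans #|powerset CC|).
  by apply: subset_leq_card; apply/subsetP => X /and3P[XC _ _]; rewrite powersetE.
rewrite card_powerset leq_pexp2l // leq_divRL // mulnC.
exact: card_large_clusters.
Qed.

(** Either the giant already has [(c + 2 * h) * n] vertices, or its cut has at least [b * a * n]
    edges. Opening a fraction [q / 2] of them absorbs enough new vertices, by the degree bound. *)
Lemma expec_growth (q c a h : R) w k : 0 <= q <= 1 ->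
  0 < a -> a <= c -> c + 2 * h <= 1 - a -> 4 * d%:R * h <= q * (b * a) ->
  k%:R <= c * n -> has_giant c w -> 0 <= h ->
  q / 2 <= expec q (enum (edges e))
    (fun w' => ((c + 2 * h) * n <= #|large k (w :|: w')|%:R)%R%:R).
Proof.
move=> q01 a0 ac cha hq kc /has_giantP[x cx] h0; have [q0 q1] := andP q01.
set W := open_cluster w x in cx *.
have reach w' : (c + 2 * h) * n <= #|open_cluster (w :|: w') x|%:R ->
    (c + 2 * h) * n <= #|large k (w :|: w')|%:R :> R.
  move=> le; apply: (le_trans le); rewrite ler_nat subset_leq_card //.
  apply/subsetP => y /eq_cluster yx; rewrite inE -yx -(ler_nat R).
  by apply: le_trans kc _; apply: le_trans le; rewrite ler_pM2r //; lra.
have WU w' : W \subset open_cluster (w :|: w') x by apply: cluster_mono; apply: subsetUl.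
have [big|small] := leP ((c + 2 * h) * n) #|W|%:R.
  apply: (@le_trans _ _ 1); first by lra.
  rewrite -[leLHS](expec_cst q (enum (edges e))); apply: expec_le => // w' _.
  rewrite reach //; apply: le_trans big _.
  by rewrite ler_nat subset_leq_card.
have cutW : b * (a * n) <= #|edge_cut e W|%:R.
  rewrite card_cut; apply: (boundary_size_ge e_simple e_cheeger b_gt0 T_gt0 a0).
  rewrite (le_trans _ cx) /= ?ler_pM2r // (le_trans (ltW small)) // ler_pM2r //.
have cut0 : 0 < #|edge_cut e W|%:R :> R by apply: lt_le_trans cutW; rewrite !mulr_gt0.
(* The level is half the mean number of opened cut edges, which leaves probability at least
   [q / 2]. *)
have := @expec_reverse_markov R _ q (enum (edges e)) (fun w' => #|edge_cut e W :&: w'|%:R)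
  #|edge_cut e W|%:R (q * #|edge_cut e W|%:R / 2) q01.
rewrite expec_card ?enum_uniq //; last first.
  by move=> i; rewrite mem_enum; apply: (subsetP (edge_cut_sub e W)).
have -> : q * #|edge_cut e W|%:R - q * #|edge_cut e W|%:R / 2 = #|edge_cut e W|%:R * (q / 2).
  by field.
rewrite ler_pM2l // => /(_ _ _)/le_trans; apply.
- by rewrite divr_ge0 // mulr_ge0 // ltW.
- by move=> w'; rewrite ler_nat subset_leq_card // subsetIl.
apply: expec_le => // w' _; case: (leP (q * #|edge_cut e W|%:R / 2)) => //= qcut; rewrite reach //.
have : #|W|%:R + #|outer e W w'|%:R <= #|open_cluster (w :|: w') x|%:R :> R.
  rewrite -natrD ler_nat -cardsUI.
  have -> : W :&: outer e W w' = set0.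
    by apply/setP => y; rewrite !inE; case: connect.
  rewrite cards0 addn0; apply: subset_leq_card; rewrite subUset WU /=.
  apply/subsetP => y; rewrite inE => /andP[_ /exists_inP[z zW /andP[_ zy]]].
  rewrite inE; apply: (@connect_trans _ _ z).
    by have := subsetP (WU w') _ zW; rewrite inE.
  by apply: connect1; rewrite /retained in_setU zy orbT.
apply: le_trans; rewrite mulrDl lerD //.
rewrite -(ler_pM2l d0); apply: (@le_trans _ _ #|edge_cut e W :&: w'|%:R); last first.
  by rewrite -natrM ler_nat card_cut_outer.
apply: le_trans qcut; apply: (@le_trans _ _ (q * (b * (a * n)) / 2)); last first.
  by rewrite ler_pM2r ?invr_gt0 // ler_wpM2l.
have -> : d%:R * (2 * h * n) = (4 * d%:R * h) * (n / 2) by field.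
have -> : q * (b * (a * n)) / 2 = (q * (b * a)) * (n / 2) by field.
by rewrite ler_wpM2r // divr_ge0 // ltW.
Qed.

(** An event of probability at least [dl] is too likely to be a deviation by [u], which forces the
    mean above [z + u]. A value below [z] is then such a deviation. *)
Lemma expec_large_concentration (p u z dl : R) k : 0 <= p <= 1 -> 0 < u ->
  dl <= expec p (enum (edges e)) (fun w => (z + 2 * u <= #|large k w|%:R)%R%:R) ->
  #|edges e|%:R * (2 * k)%:R ^+ 2 < dl * u ^+ 2 ->
  expec p (enum (edges e)) (fun w => (#|large k w|%:R < z)%R%:R) * u ^+ 2
    <= #|edges e|%:R * (2 * k)%:R ^+ 2.
Proof.
move=> p01 u0 dlP Vdl; set f := fun w : {set {set T}} => #|large k w|%:R : R.
have := @expec_chebyshev R _ p (enum (edges e)) f (2 * k)%:R u p01 (ltW u0).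
have u2 : 0 < u ^+ 2 by rewrite exprn_gt0.
set mu := expec p _ f; rewrite -cardE => cheb.
have {}cheb : expec p (enum (edges e)) (fun w => (u <= `|f w - mu|)%R%:R) * u ^+ 2
    <= #|edges e|%:R * (2 * k)%:R ^+ 2.
  apply: cheb => i w; rewrite mem_enum => /edgesP[x [y [_ ->]]].
  have le1 : f w <= f ([set x; y] |: w).
    by rewrite ler_nat subset_leq_card // large_mono // subsetUr.
  have le2 : f ([set x; y] |: w) <= f w + (2 * k)%:R.
    by rewrite -natrD ler_nat card_large_insert.
  by rewrite ger0_norm ?subr_ge0 // lerBlDl.
have muz : z + u < mu.
  rewrite ltNge; apply/negP => muz; move: Vdl; rewrite ltNge => /negP; apply.
  apply: le_trans cheb; rewrite ler_pM2r //; apply: le_trans dlP _.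
  apply: expec_le => // w _; case: (leP (z + 2 * u)) => //= zf.
  by have -> : u <= `|f w - mu| by rewrite ler_normr; apply/orP; left; rewrite /f; lra.
apply: le_trans cheb; rewrite ler_pM2r //.
apply: expec_le => // w _; case: (ltP _ z) => //= zf.
by have -> : u <= `|f w - mu| by rewrite ler_normr; apply/orP; right; rewrite /f; lra.
Qed.

(** * First moment bounds on the probability of a giant *)

Lemma retained_neighbour w x y : connect (retained w) x y -> x != y ->
  exists z, retained w x z.
Proof.
by move=> /connectP[[|z s] /= + ->]; rewrite ?eqxx // => /andP[xz _]; exists z.
Qed.

(** Every vertex of a nontrivial cluster is an endpoint of an open edge. *)
Lemma card_cluster_le w x : w \subset edges e -> (1 < #|open_cluster w x|)%N ->
  (#|open_cluster w x| <= 2 * #|w|)%N.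
Proof.
move=> we C1; have sub : open_cluster w x \subset cover w.
  apply/subsetP => y yC.
  have [z zC yz] : exists2 z, z \in open_cluster w x & y != z.
    move: C1; rewrite (cardsD1 y) yC => /card_gt0P[z]; rewrite inE in_set1.
    by move=> /andP[zy zC]; exists z; rewrite // eq_sym.
  have [|u yu] := @retained_neighbour w y z _ yz.
    by move: zC; rewrite (eq_cluster yC) inE.
  by apply/bigcupP; exists [set y; u]; rewrite ?set21.
apply: leq_trans (subset_leq_card sub) _; apply: leq_trans (leq_card_cover _) _.
rewrite mulnC -sum_nat_const; apply: leq_sum => i /(subsetP we)/edgesP[u [v [_ ->]]].
by rewrite cards2; case: eqP.
Qed.

(** A giant forces [c * n / 2] open edges, while at most [p * d * n] are expected; Markov concludes.
    The bound [2 <= c * n] excludes giants made of one vertex. *)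
Lemma expec_giant_le_half (p c : R) : 0 <= p <= 1 -> 2 <= c * n -> 0 < c ->
  4 * d%:R * p <= c ->
  expec p (enum (edges e)) (fun w => (has_giant c w)%:R) <= 2^-1.
Proof.
move=> p01 cn2 c0 dp; have [p0 p1] := andP p01.
have := @expec_markov R _ p (enum (edges e)) (fun w => #|edges e :&: w|%:R)
  (c * n / 2) p01 (fun w => ler0n _ _).
rewrite expec_card ?enum_uniq //; last by move=> i; rewrite mem_enum.
set P := expec _ _ _ => mkv.
have cn0 : 0 < c * n by rewrite mulr_gt0.
apply: (@le_trans _ _ P).
  apply: expec_le => // w we; have [/has_giantP[x cx]|] := boolP (has_giant c w); last by [].
  have we' : w \subset edges e by apply/subsetP => i /we; rewrite mem_enum.
  rewrite (setIidPr we') ler_pdivrMr // (le_trans cx) // -natrM ler_nat mulnC.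
  by rewrite card_cluster_le // -(ler_nat R); apply: le_trans cx.
have Ed : #|edges e|%:R <= d%:R * n by rewrite -natrM ler_nat card_edges.
rewrite -(ler_pM2l (_ : 0 < c * n / 2)) ?divr_gt0 //; apply: le_trans mkv _.
apply: (@le_trans _ _ (p * (d%:R * n))); first exact: ler_wpM2l.
have -> : p * (d%:R * n) = (4 * d%:R * p) * (n / 4) by field.
have -> : c * n / 2 * 2^-1 = c * (n / 4) by field.
by rewrite ler_wpM2r // divr_ge0 // ltW.
Qed.

(** Without a giant some stable set has between [a * n] and [(1 - a) * n] vertices. Its whole cut is
    closed, so at least [b * a * n] edges are; Markov bounds the chance of that. *)
Lemma expec_giant_ge_half (p c a : R) : 0 <= p <= 1 -> 0 < a -> 3 * a <= 1 ->
  c + a <= 1 -> 2 * d%:R * (1 - p) <= b * a ->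
  2^-1 <= expec p (enum (edges e)) (fun w => (has_giant c w)%:R).
Proof.
move=> p01 a0 a3 ca dp; have [p0 p1] := andP p01.
have E w : #|edges e :\: w|%:R = #|edges e|%:R + (-1) * #|edges e :&: w|%:R :> R.
  by rewrite mulN1r -(cardsID w (edges e)) natrD; ring.
have := @expec_markov R _ p (enum (edges e)) (fun w => #|edges e :\: w|%:R)
  (b * (a * n)) p01 (fun w => ler0n _ _).
have -> : (fun w => #|edges e :\: w|%:R) =
  (fun w => #|edges e|%:R + (-1) * #|edges e :&: w|%:R) :> (_ -> R).
  by apply/funext => w; rewrite E.
rewrite expecD expec_cst expecZ expec_card ?enum_uniq //; last first.
  by move=> i; rewrite mem_enum.
set P := expec _ _ _ => mkv.
have an0 : 0 < b * (a * n) by rewrite !mulr_gt0.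
have Ed : #|edges e|%:R <= d%:R * n by rewrite -natrM ler_nat card_edges.
have P2 : P <= 2^-1.
  rewrite -(ler_pM2l an0); apply: le_trans mkv _.
  have -> : #|edges e|%:R + -1 * (p * #|edges e|%:R) = (1 - p) * #|edges e|%:R :> R.
    by ring.
  apply: (@le_trans _ _ ((1 - p) * (d%:R * n))); first by rewrite ler_wpM2l // subr_ge0.
  have -> : (1 - p) * (d%:R * n) = (2 * d%:R * (1 - p)) * (n / 2) by field.
  have -> : b * (a * n) * 2^-1 = (b * a) * (n / 2) by field.
  by rewrite ler_wpM2r // divr_ge0 // ltW.
have : 1 <= expec p (enum (edges e)) (fun w => (has_giant c w)%:R) + P.
  rewrite -expecD -[leLHS](expec_cst p (enum (edges e))); apply: expec_le => // w _.
  have [_|small] := boolP (has_giant c w); first by rewrite lerDl.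
  rewrite add0r; have cT : #|[set: T]|%:R = n :> R by rewrite cardsT.
  have [||S stS] := @no_giant_split c (a * n) w setT small.
  - by rewrite cT mulrA -[leRHS]mul1r ler_pM2r.
  - by rewrite cT -mulrDl -[leRHS]mul1r ler_pM2r.
  rewrite setIT cT => aS.
  have -> : b * (a * n) <= #|edges e :\: w|%:R; last by [].
  apply: (@le_trans _ _ (boundary_size e S)%:R).
    apply: (boundary_size_ge e_simple e_cheeger b_gt0 T_gt0 a0).
    by rewrite mulrBl mul1r.
  rewrite -card_cut ler_nat subset_leq_card //; apply/subsetP => i iS.
  rewrite in_setD (subsetP (edge_cut_sub e S)) // andbT.
  move: iS => /edge_cutP[x [y [xS yS _ ->]]]; apply: contra yS => xy.
  by apply: (stableP stS xS); apply: connect1.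
by move: P2; lra.
Qed.

End Giant.

(** * Sharp threshold *)

Lemma prob_giantE (R : realType) (T : finType) (e : rel T) (p c : R) :
  prob_giant e p c = expec p (enum (edges e)) (fun w => (has_giant c w)%:R).
Proof.
rewrite expecE ?enum_uniq // /prob_giant big_mkcondr /= -cardE.
apply: eq_big => w.
  by apply: eq_subset_r => i; rewrite mem_enum.
by move=> _; case: has_giant; rewrite ?mulr1 ?mulr0.
Qed.

Lemma prob_giant_itv (R : realType) (T : finType) (e : rel T) (p c : R) :
  0 <= p <= 1 -> 0 <= prob_giant e p c <= 1.
Proof.
move=> p01; rewrite prob_giantE expec_ge0 //=.
rewrite -[leRHS](expec_cst p (enum (edges e))); apply: expec_le => // w _.
by case: has_giant.
Qed.

Lemma prob_giant_incr (R : realType) (T : finType) (e : rel T) (p p' c : R) :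
  0 <= p -> p <= p' -> p' <= 1 -> prob_giant e p c <= prob_giant e p' c.
Proof.
move=> p0 pp' p'1; rewrite !prob_giantE; apply: expec_incr => // w w'.
by case: (boolP (has_giant c w)) => // g; rewrite has_giantU.
Qed.

Lemma exists_nat_gt (R : realType) (x : R) : exists m : nat, x < m%:R.
Proof.
exists (Num.bound `|x|); apply: le_lt_trans (ler_norm x) _; exact: archi_boundP.
Qed.

(** Bernoulli's inequality gives the decay [1 / (1 + j * x)]. *)
Lemma exists_expr_le (R : realType) (x y : R) : 0 < x -> x <= 1 -> 0 < y ->
  exists j, (1 - x) ^+ j <= y.
Proof.
move=> x0 x1 y0.
have bernoulli j : (1 - x) ^+ j * (1 + j%:R * x) <= 1.
  elim: j => [|j IH]; first by rewrite expr0 mul0r addr0 mulr1.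
  apply: le_trans IH; rewrite exprSr -mulrA; apply: ler_wpM2l.
    by rewrite exprn_ge0 // subr_ge0.
  rewrite -natr1; have : 0 <= j%:R :> R by []; have : 0 <= x ^+ 2 by apply: sqr_ge0.
  by move=> ? ?; nra.
have [j jy] := exists_nat_gt ((y * x)^-1); exists j.
have xj : 0 < 1 + j%:R * x.
  by apply: ltr_wpDr => //; rewrite mulr_ge0 // ltW.
rewrite -(ler_pM2r xj); apply: le_trans (bernoulli j) _.
have : 1 < j%:R * (y * x) by rewrite -ltr_pdivrMr ?mul1r ?mulr_gt0.
by nra.
Qed.

Lemma sharp_threshold (R : realType) (b c eps dl : R) (d : nat) :
  0 < b -> (0 < d)%N -> 0 < c < 1 -> 0 < eps <= 1 -> 0 < dl ->
  exists N : nat, forall (T : finType) (e : rel T), simple_graph e ->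
    max_degree_le e d -> cheeger_gt e b -> (N <= #|T|)%N ->
    forall p p' : R, 0 <= p -> p + eps <= p' -> p' <= 1 ->
    dl <= prob_giant e p c -> 1 - dl <= prob_giant e p' c.
Proof.
move=> b0 dpos /andP[c0 c1] /andP[eps0 eps1] dl0.
have d0 : 0 < d%:R :> R by rewrite ltr0n.
have [q qE] : exists q : R, 2 * q = eps by exists (eps / 2); field.
have q0 : 0 < q by lra.
have q1 : q <= 1 by lra.
have q01 : 0 <= q <= 1 by rewrite ltW.
(* With [h <= (1 - c) / 4] this ensures [c + 2 * h <= 1 - a]. The other two bounds in [h] serve
   [expec_merge] and [expec_growth]. *)
pose a := Num.min c ((1 - c) / 2).
have a0 : 0 < a by rewrite lt_min c0 divr_gt0 // subr_gt0.
have ac : a <= c by rewrite ge_min lexx.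
have ac1 : a <= (1 - c) / 2 by rewrite ge_min lexx orbT.
pose h := Num.min (Num.min (c / 3) ((1 - c) / 4)) (q * (b * a) / (4 * d%:R)).
have h0 : 0 < h.
  rewrite !lt_min; apply/andP; split; first by apply/andP; split; lra.
  by rewrite divr_gt0 ?mulr_gt0.
have h3 : 3 * h <= c.
  have : h <= c / 3 by rewrite !ge_min lexx.
  by lra.
have h4 : h <= (1 - c) / 4 by rewrite !ge_min lexx !orbT.
have hq : 4 * d%:R * h <= q * (b * a).
  have : h <= q * (b * a) / (4 * d%:R) by rewrite ge_min lexx orbT.
  by rewrite ler_pdivlMr ?mulr_gt0 // mulrC.
have bh0 : 0 < b * h by rewrite mulr_gt0.
have [r rd] : exists r : nat, d%:R < r%:R * (b * h).
  have [r rd] := exists_nat_gt (d%:R / (b * h)).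
  by exists r; rewrite -ltr_pdivrMr.
(* With [j] paths for each of the [M] potential large clusters, the failure probability [4^-M] beats
   the [2^M] splittings. *)
have [j rho_j] : exists j, (1 - q ^+ (2 * r)) ^+ j <= 4^-1.
  apply: exists_expr_le; rewrite ?exprn_gt0 ?invr_gt0 //.
  by apply: exprn_ile1 => //; apply: ltW.
(* For such [k] all [j * M] paths, with [M] at most [n / k], fit in the budget of [b * h * n / 2]
   edges. *)
have [k0 kj] : exists k : nat, 4 * (r * j)%:R / (b * h) < k%:R by apply: exists_nat_gt.
pose k := k0.+1.
have {}kj : 4 * (r * j)%:R <= k%:R * (b * h).
  rewrite -ler_pdivrMr //; apply: (le_trans (ltW kj)).
  by rewrite ler_nat leqnSn.
have [dl' dl'E] : exists dl' : R, dl' = q / 2 * dl by exists (q / 2 * dl).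
have dl'0 : 0 < dl' by rewrite dl'E !mulr_gt0 ?invr_gt0.
(* [N1] makes giants large clusters, [N2] makes the variance small, and [N3] gives
   [2^-M <= dl / 2]. *)
have [N1 N1P] := exists_nat_gt (k%:R / c).
have [N2 N2P] := exists_nat_gt (32 * d%:R * k%:R ^+ 2 / (dl' * h ^+ 2)).
have [N3 N3P] := exists_nat_gt (2 / dl).
exists (N1 + N2 + k * N3.+1)%N => T e e_simple e_deg e_cheeger leN p p' p0 pp' p'1.
set n : R := #|T|%:R.
have T0 : (0 < #|T|)%N by apply: leq_trans leN; rewrite addn_gt0 muln_gt0 orbT.
have n0 : 0 < n by rewrite ltr0n.
have kc : k%:R <= c * n.
  rewrite mulrC -ler_pdivrMr //; apply: (le_trans (ltW N1P)); rewrite ler_nat.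
  by apply: leq_trans leN; rewrite -addnA leq_addr.
have nd : 32 * d%:R * k%:R ^+ 2 < dl' * h ^+ 2 * n.
  rewrite [ltRHS]mulrC -ltr_pdivrMr ?mulr_gt0 ?exprn_gt0 //.
  apply: (lt_le_trans N2P); rewrite ler_nat.
  by apply: leq_trans leN; rewrite addnAC leq_addl.
pose M := (#|T| %/ k)%N.
have MN3 : 2 / dl < M%:R.
  apply: (lt_le_trans N3P); rewrite ler_nat leq_divRL // mulnC.
  by apply: leq_trans leN; rewrite mulnS; rewrite addnA leq_addl.
have Mk : M%:R * k%:R <= n by rewrite -natrM ler_nat leq_divM.
set s := enum (edges e).
pose f (w : {set {set T}}) : R := #|large k w|%:R.
(* The levels after the first and the second sprinkling. *)
pose p2 := 1 - (1 - p) * (1 - q); pose p3 := 1 - (1 - p2) * (1 - q).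
have p1 : p <= 1 by lra.
have p01 : 0 <= p <= 1 by rewrite p0.
have p2_01 : 0 <= p2 <= 1 by rewrite /p2; apply/andP; split; nra.
have p3_p' : p3 <= p'.
  have -> : p3 = p + 2 * q - (2 * p * q + q ^+ 2 * (1 - p)) by rewrite /p3 /p2; ring.
  have : 0 <= 2 * p * q + q ^+ 2 * (1 - p).
    by rewrite addr_ge0 // mulr_ge0 ?subr_ge0 ?mulr_ge0 ?exprn_ge0 // ltW.
  by lra.
have p3_0 : 0 <= p3 by rewrite /p3; case/andP: p2_01 => ? ?; nra.
move=> dlP.
have grown : dl' <= expec p2 s (fun w => ((c + 2 * h) * n <= f w)%R%:R).
  rewrite -expecU; apply: (@le_trans _ _ (q / 2 * prob_giant e p c)).
    by rewrite dl'E ler_pM2l ?divr_gt0.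
  rewrite prob_giantE -expecZ; apply: expec_le => // w _.
  have [g|_] := boolP (has_giant c w); last by rewrite mulr0 expec_ge0.
  rewrite mulr1; have cha : c + 2 * h <= 1 - a by lra.
  by apply: (@expec_growth R T e d b e_simple e_deg e_cheeger b0 dpos T0 q c a)
    => //; apply: ltW.
pose u := h * n / 2; have u0 : 0 < u by rewrite divr_gt0 ?mulr_gt0.
have Vdl : #|edges e|%:R * (2 * k)%:R ^+ 2 < dl' / 2 * u ^+ 2.
  apply: (@le_lt_trans _ _ (d%:R * n * (2 * k)%:R ^+ 2)).
    by rewrite ler_wpM2r ?exprn_ge0 // -natrM ler_nat card_edges.
  have -> : d%:R * n * (2 * k)%:R ^+ 2 = 32 * d%:R * k%:R ^+ 2 * (n / 8) :> R.
    by rewrite natrM; field.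
  have -> : dl' / 2 * u ^+ 2 = dl' * h ^+ 2 * n * (n / 8) by rewrite /u; field.
  by rewrite ltr_pM2r // divr_gt0.
have u20 : 0 < u ^+ 2 by rewrite exprn_gt0.
have conc : expec p2 s (fun w => (f w < (c + h) * n)%R%:R) <= dl / 2.
  rewrite -(ler_pM2r u20); apply: (@le_trans _ _ (#|edges e|%:R * (2 * k)%:R ^+ 2)).
    apply: (@expec_large_concentration R T e p2 u ((c + h) * n) dl' k) => //.
      by have -> : (c + h) * n + 2 * u = (c + 2 * h) * n by rewrite /u; field.
    apply: lt_le_trans Vdl _; rewrite ler_pM2r //; lra.
  apply: (le_trans (ltW Vdl)); rewrite ler_pM2r //.
  by rewrite ler_pM2r ?invr_gt0 // dl'E; nra.
apply: (@le_trans _ _ (prob_giant e p3 c)); last exact: prob_giant_incr.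
pose m := (j * M)%N.
have rho0 : 0 <= 1 - q ^+ (2 * r) by rewrite subr_ge0 exprn_ile1 // ltW.
have mr : (m * (2 * r))%:R <= b * (h * n) / 2.
  have -> : (m * (2 * r))%:R = (4 * (r * j)%:R) * (M%:R / 2) :> R.
    by rewrite /m !natrM; field.
  apply: (@le_trans _ _ (k%:R * (b * h) * (M%:R / 2))).
    by rewrite ler_wpM2r // divr_ge0.
  have -> : k%:R * (b * h) * (M%:R / 2) = (b * h / 2) * (M%:R * k%:R) by field.
  have -> : b * (h * n) / 2 = (b * h / 2) * n by field.
  by rewrite ler_wpM2l // divr_ge0 // ltW.
have tiny : 2 ^+ M * (1 - q ^+ (2 * r)) ^+ m <= dl / 2.
  apply: (@le_trans _ _ (2 ^+ M * 4^-1 ^+ M)).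
    rewrite ler_wpM2l ?exprn_ge0 // /m exprM; apply: lerXn2r => //;
      by rewrite nnegrE ?exprn_ge0 ?invr_ge0.
  rewrite -exprMn; have -> : 2 * 4^-1 = 2^-1 :> R by field.
  rewrite exprVn invf_ple ?posrE ?exprn_gt0 ?divr_gt0 //.
  have -> : (dl / 2)^-1 = 2 / dl by field; rewrite lt0r_neq0.
  apply: (le_trans (ltW MN3)); rewrite -natrX ler_nat; exact/ltnW/ltn_expl.
suff : expec p3 s (fun w => (~~ has_giant c w)%:R) <= dl.
  have : 1 <= prob_giant e p3 c + expec p3 s (fun w => (~~ has_giant c w)%:R).
    rewrite prob_giantE -expecD -[leLHS](expec_cst p3 s); apply: expec_le => [|w _].
      by rewrite p3_0 (le_trans p3_p').
    by case: has_giant; rewrite ?addr0 ?add0r.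
  by lra.
rewrite /p3 -expecU.
(* Either there are too few vertices in large clusters, or the second sprinkling merges them except
   with probability [dl / 2]. *)
apply: (@le_trans _ _ (expec p2 s (fun w => (f w < (c + h) * n)%R%:R + dl / 2))).
  apply: expec_le => // w _; case: ltP => /= fw; last first.
    rewrite add0r; apply: le_trans tiny.
    exact: (@expec_merge R T e d b e_simple e_deg e_cheeger b0 dpos T0 q c h).
  apply: (@le_trans _ _ 1); last by rewrite lerDl divr_ge0 // ltW.
  rewrite -[leRHS](expec_cst q s); apply: expec_le => // w' _.
  by case: has_giant.
by rewrite expecD expec_cst; lra.
Qed.

(** The threshold is the supremum of the levels in [[a, a']] where [f] is at most one half. It
    defaults to [a] when there are none, so that [z] lies in the interval even if the bounds at [a]
    and [a'] fail. *)
Lemma threshold_exists (R : realType) (f : R -> R) (a a' : R) : 0 <= a -> a < a' -> a' <= 1 ->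
  (forall p p', 0 <= p -> p <= p' -> p' <= 1 -> f p <= f p') ->
  exists2 z, a <= z <= a' &
    f a <= 2^-1 -> 2^-1 <= f a' ->
    (forall p, z < p -> p <= 1 -> 2^-1 <= f p) /\
    (forall p, 0 <= p -> p < z -> f p <= 2^-1).
Proof.
move=> a0 aa' a'1 f_incr.
pose E : set R := [set p | a <= p <= a' /\ f p <= 2^-1]%classic.
pose z := if f a <= 2^-1 then sup E else a.
have Eub : has_ubound E by exists a' => p [/andP[]].
exists z.
  rewrite /z; case: ifP => fa; last by rewrite lexx ltW.
  have Ea : E a by split=> //; rewrite lexx ltW.
  rewrite (ub_le_sup Eub Ea) /=; apply: sup_le_ub; first by exists a.
  by move=> p [/andP[]].
move=> fa fa'; have Ea : E a by split=> //; rewrite lexx ltW.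
rewrite /z fa; split=> p.
  move=> zp p1; have [pa'|a'p] := leP p a'; last first.
    by apply: le_trans fa' _; apply: f_incr => //; [lra | exact: ltW].
  rewrite leNgt; apply/negP => fp; have : E p.
    split; last exact: ltW.
    by rewrite pa' andbT; apply: le_trans (ltW zp); apply: ub_le_sup.
  by move=> /(ub_le_sup Eub); rewrite leNgt zp.
move=> p0 pz; have [x [/andP[ax xa'] fx] px] : exists2 x, E x & p < x.
  by apply: sup_gt pz; exists a.
by apply: le_trans fx; apply: f_incr => //; [exact: ltW | lra].
Qed.

Local Open Scope classical_set_scope.
Local Open Scope ring_scope.

Theorem theorem1p3 (R : realType) (T : nat -> finType) (e : forall n, rel (T n)) :
  expander R e ->
  forall c : R, 0 < c < 1 ->
  exists pstar : nat -> R,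
    (exists a a' : R, 0 < a /\ a < a' /\ a' < 1 /\ forall n, a <= pstar n <= a') /\
    forall eps : R, 0 < eps ->
    forall p : nat -> R, (forall n, 0 <= p n <= 1) ->
      ((forall n, pstar n + eps <= p n) ->
         prob_giant (e n) (p n) c @[n --> \oo] --> (1 : R)) /\
      ((forall n, p n <= pstar n - eps) ->
         prob_giant (e n) (p n) c @[n --> \oo] --> (0 : R)).
Proof.
move=> [e_simple [[b [d [b0 [d0 e_exp]]]] T_infty]] c c01.
have [c0 c1] := andP c01.
have d1 : 1 <= d%:R :> R by rewrite ler1n.
have [al [al0 al3 cal]] : exists al : R, [/\ 0 < al, 3 * al <= 1 & c + al <= 1].
  by exists ((1 - c) / 3); split; lra.
(* The level [a] meets the condition of [expec_giant_le_half]; below, [1 - g] meets that of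
   [expec_giant_ge_half]. *)
have [a aE] : exists a : R, 4 * d%:R * a = c.
  by exists (c / (4 * d%:R)); field; rewrite lt0r_neq0 //; lra.
have a0 : 0 < a by rewrite -(pmulr_rgt0 _ (_ : 0 < 4 * d%:R)) ?aE //; lra.
have a4 : a < 4^-1 by nra.
have [g [g0 g2 gb]] : exists g : R, [/\ 0 < g, g <= 2^-1 & 2 * d%:R * g <= b * al].
  exists (Num.min 2^-1 (b * al / (2 * d%:R))); split.
  - by rewrite lt_min invr_gt0 ltr0n divr_gt0 ?mulr_gt0 // ltr0n.
  - by rewrite ge_min lexx.
  rewrite mulrC -ler_pdivlMr ?mulr_gt0 ?ltr0n //.
  by rewrite ge_min lexx orbT.
pose a' := 1 - g; have a'1 : a' < 1 by rewrite /a'; lra.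
have thr n : exists z : R, a <= z <= a' /\
    (prob_giant (e n) a c <= 2^-1 -> 2^-1 <= prob_giant (e n) a' c ->
      (forall p, z < p -> p <= 1 -> 2^-1 <= prob_giant (e n) p c) /\
      (forall p, 0 <= p -> p < z -> prob_giant (e n) p c <= 2^-1)).
  have [||||z za' zP] := @threshold_exists R (fun p => prob_giant (e n) p c) a a'.
  - exact: ltW.
  - by rewrite /a'; lra.
  - by rewrite /a'; lra.
  - by move=> p p'; apply: prob_giant_incr.
  by exists z.
have [pstar pstarP] := choice thr.
exists pstar; split.
  exists a, a'; do 3 (split; first by rewrite /a'; lra).
  by move=> n; have [] := pstarP n.
(* The first moment bounds need [2 <= c * #|T n|], so [pstar n] separates at one half only for large
   [n]. *)
have [M0 M0P] := exists_nat_gt (2 / c).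
have [N0 N0P] := T_infty M0.+1.
have half n : (N0 <= n)%N ->
    (forall p, pstar n < p -> p <= 1 -> 2^-1 <= prob_giant (e n) p c) /\
    (forall p, 0 <= p -> p < pstar n -> prob_giant (e n) p c <= 2^-1).
  move=> /N0P Mn; have [deg che] := e_exp n.
  have T0 : (0 < #|T n|)%N by apply: leq_trans Mn.
  have cT : 2 <= c * #|T n|%:R.
    rewrite mulrC -ler_pdivrMr //; apply: (le_trans (ltW M0P)).
    by rewrite ler_nat ltnW.
  apply: (pstarP n).2; rewrite prob_giantE.
    apply: (expec_giant_le_half (e_simple n) deg T0) => //; last by rewrite aE.
    by apply/andP; split; lra.
  apply: (expec_giant_ge_half (e_simple n) deg che b0 T0 _ al0) => //.
    by rewrite /a'; apply/andP; split; lra.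
  by rewrite /a'; have -> : 1 - (1 - g) = g by ring.
move=> eps eps0 p p01.
(* One [eps'] moves strictly past [pstar n], where the bound one half holds; the other is the
   sprinkling of [sharp_threshold]. *)
have [eps' [eps'0 eps'1 eps'2]] : exists eps' : R,
    [/\ 0 < eps', eps' <= 1 & 2 * eps' <= eps].
  exists (Num.min 1 (eps / 2)); split.
  - by rewrite lt_min ltr01 divr_gt0.
  - by rewrite ge_min lexx.
  by rewrite mulrC -ler_pdivlMr // ge_min lexx orbT.
have sharp (dl : R) : 0 < dl -> exists N, forall n, (N <= n)%N ->
    forall p p' : R, 0 <= p -> p + eps' <= p' -> p' <= 1 ->
    dl <= prob_giant (e n) p c -> 1 - dl <= prob_giant (e n) p' c.
  move=> dl0; have [|N NP] := sharp_threshold b0 d0 c01 (_ : 0 < eps' <= 1) dl0.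
    by rewrite eps'0.
  have [N' N'P] := T_infty N; exists N' => n /N'P Nn.
  have [deg che] := e_exp n; exact: NP.
(* The cap [3^-1] gives [dl' < 2^-1 < 1 - dl']: part (i) uses the first inequality and part (ii) the
   second. *)
have small (dl : R) : 0 < dl -> exists dl' : R, [/\ 0 < dl', dl' <= dl & dl' <= 3^-1].
  move=> dl0; exists (Num.min dl 3^-1); split.
  - by rewrite lt_min dl0 invr_gt0 ltr0n.
  - by rewrite ge_min lexx.
  by rewrite ge_min lexx orbT.
split=> pP; apply/cvgrPdist_le => dl /small[dl' [dl'0 dl'dl dl'3]];
  have [N NP] := sharp dl' dl'0; exists (maxn N0 N) => // n /=;
  rewrite geq_max => /andP[/half[above below] /NP Nn];
  have [pn0 pn1] := andP (p01 n); have := pP n;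
  have [/andP[az za'] _] := pstarP n;
  have /andP[f0 f1] := prob_giant_itv (e n) c (p01 n) => pn.
  have fr : 2^-1 <= prob_giant (e n) (pstar n + eps') c by apply: above; lra.
  have := Nn (pstar n + eps') (p n); rewrite ger0_norm ?subr_ge0 // => big.
  have : 1 - dl' <= prob_giant (e n) (p n) c by apply: big => //; lra.
  by lra.
have fr : prob_giant (e n) (pstar n - eps') c <= 2^-1 by apply: below; lra.
rewrite sub0r normrN ger0_norm //; apply: le_trans dl'dl.
(* Probability above [dl'] at [p n] would climb to [1 - dl'] at [pstar n - eps'], where it is at
   most one half. *)
rewrite leNgt; apply/negP => /ltW /(Nn (p n) (pstar n - eps')) big.
have : 1 - dl' <= prob_giant (e n) (pstar n - eps') c by apply: big => //; lra.
by lra.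
Qed.
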